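(* Let $X$ be a Banach space, let $G$ be a semitopological semigroup, and let $\mathcal{S}=\{S_g : g\in G\}$ be a bounded representation of $G$ on $X$. (A) If $\mathcal{S}$ is amenable, then there exists a strong $\mathcal{S}$-ergodic net. (B) If $\mathcal{S}$ is right amenable, then there exists a strong right $\mathcal{S}$-ergodic net.
   Context: A semitopological semigroup is a semigroup with a topology for which multiplication is separately continuous. $\mathcal{L}(X)$ denotes the bounded linear operators on $X$, endowed with the strong operator topology. A bounded representation of $G$ on $X$ is a family $\mathcal{S}=\{S_g:g\in G\}\subset\mathcal{L}(X)$ with $\sup_{g\in G}\|S_g\|<\infty$, $S_gS_h=S_{hg}$ for all $g,h\in G$, and $g\mapsto S_gx$ (norm-)continuous for every $x\in X$. $\mathcal{S}$ is regarded as a semigroup of operators under composition with the strong operator topology. $\overline{\mathrm{co}}\,\mathcal{S}$ denotes the closure of the convex hull of $\mathcal{S}$ in the strong operator topology. For a semitopological semigroup $T$, $C_b(T)$ is the space of bounded continuous functions on $T$; a mean is a functional $m\in C_b(T)'$ with $\langle m,\mathbf{1}\rangle=\|m\|=1$. It is right (resp. left) invariant if $\langle m,R_tf\rangle=\langle m,f\rangle$ (resp. $\langle m,L_tf\rangle=\langle m,f\rangle$) for all $t\in T$, $f\in C_b(T)$, where $R_tf(s)=f(st)$ and $L_tf(s)=f(ts)$. It is invariant if it is both right and left invariant. $T$ is right amenable (resp. amenable) if a right invariant (resp. invariant) mean on $C_b(T)$ exists. A net $(A_\alpha)_{\alpha\in\mathcal{A}}$ in $\mathcal{L}(X)$ is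 a strong right (resp. strong left) $\mathcal{S}$-ergodic net if $A_\alpha\in\overline{\mathrm{co}}\,\mathcal{S}$ for all $\alpha$ and, for all $x\in X$ and $g\in G$, $\lim_\alpha (A_\alpha x-A_\alpha S_gx)=0$ (resp. $\lim_\alpha(A_\alpha x-S_gA_\alpha x)=0$) in norm. It is a strong $\mathcal{S}$-ergodic net if it is both a strong right and a strong left $\mathcal{S}$-ergodic net. *)

(* Defs.v *)
From HB Require Import structures.
From mathcomp Require Import all_boot all_order all_algebra.
From mathcomp Require Import complex.
From mathcomp Require Import all_classical all_reals all_analysis.

Set Implicit Arguments.
Unset Strict Implicit.
Unset Printing Implicit Defensive.

Import Order.TTheory GRing.Theory Num.Theory.
Import numFieldNormedType.Exports.

Local Open Scope classical_set_scope.
Local Open Scope ring_scope.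

(* Banach spaces may be real or complex: the scalar field is either the given
   model R of the reals or the field R[i] over it. *)
Variant scalar_kind := RealScalars | ComplexScalars.

Definition scalars (R : realType) (k : scalar_kind) : numFieldType :=
  match k with
  | RealScalars => R
  | ComplexScalars => R[i]
  end.

HB.mixin Record isSeparatelyContinuous G of Semigroup G & Topological G := {
  mulg_continuousl : forall h : G, continuous (fun g : G => (h * g)%g) ;
  mulg_continuousr : forall h : G, continuous (fun g : G => (g * h)%g)
}.

#[short(type="semitopSemigroupType")]
HB.structure Definition SemitopologicalSemigroup :=
  {G of Semigroup G & Topological G & isSeparatelyContinuous G}.

Section bounded_continuous_functions.
Context (K : numFieldType) (T : topologicalType).

Definition bcfun_pred : {pred T -> K^o} := [pred f : T -> K^o |
  `[< (exists M : K, forall t, `|f t| <= M) /\ continuous f >]].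

Lemma bcfun_submod_closed : submod_closed bcfun_pred.
Proof.
split.
  by apply/asboolP; split; [exists 0 => t; rewrite normr0|exact: cst_continuous].
move=> a f g /asboolP[[M fM] cf] /asboolP[[N gN] cg]; apply/asboolP; split.
  exists (`|a| * M + N) => t /=.
  by rewrite (le_trans (ler_normD _ _))// lerD// normrM ler_wpM2l.
by move=> t; apply: cvgD; [apply: cvgZr; exact: cf|exact: cg].
Qed.

HB.instance Definition _ :=
  GRing.isSubmodClosed.Build _ _ bcfun_pred bcfun_submod_closed.

Record bcfun := BCFun {
  bcfun_fun :> T -> K^o ; bcfun_mem : bcfun_fun \in bcfun_pred }.

HB.instance Definition _ := [isSub for bcfun_fun].
HB.instance Definition _ := [Choice of bcfun by <:].
HB.instance Definition _ := [SubChoice_isSubLmodule of bcfun by <:].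

Lemma bcfunP (f : bcfun) :
  (exists M : K, forall t, `|f t| <= M) /\ continuous f.
Proof. exact/asboolP/bcfun_mem. Qed.

Lemma bcfun1_subproof : (fun=> 1) \in bcfun_pred.
Proof.
by apply/asboolP; split; [exists 1 => t; rewrite normr1|exact: cst_continuous].
Qed.

Definition bcfun1 : bcfun := BCFun bcfun1_subproof.

(* Closed unit ball for the supremum norm. *)
Definition bcfun_unit_ball : set bcfun := [set f | forall t, `|f t| <= 1].

(* The last condition says that the dual norm of m, i.e. the supremum of
   `|m f| over the closed unit ball, equals 1. *)
Definition is_mean (m : {scalar bcfun}) : Prop :=
  m bcfun1 = 1 /\ supremums [set `|m f| | f in bcfun_unit_ball] 1.

End bounded_continuous_functions.

Section translations.
Context (K : numFieldType) (T : semitopSemigroupType).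
Implicit Types (t : T) (f : bcfun K T).

Lemma rtranslate_subproof t f : (fun s => f (s * t)%g) \in @bcfun_pred K T.
Proof.
have [[M fM] cf] := bcfunP f; apply/asboolP; split; first by exists M.
move=> s; apply: (continuous_comp (mulg_continuousr t s)); exact: cf.
Qed.

Lemma ltranslate_subproof t f : (fun s => f (t * s)%g) \in @bcfun_pred K T.
Proof.
have [[M fM] cf] := bcfunP f; apply/asboolP; split; first by exists M.
move=> s; apply: (continuous_comp (mulg_continuousl t s)); exact: cf.
Qed.

Definition rtranslate t f : bcfun K T := BCFun (rtranslate_subproof t f).
Definition ltranslate t f : bcfun K T := BCFun (ltranslate_subproof t f).

Definition right_invariant (m : {scalar bcfun K T}) : Prop :=
  forall t f, m (rtranslate t f) = m f.

Definition left_invariant (m : {scalar bcfun K T}) : Prop :=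
  forall t f, m (ltranslate t f) = m f.

End translations.

Definition right_amenable (K : numFieldType) (T : semitopSemigroupType) : Prop :=
  exists m : {scalar bcfun K T}, is_mean m /\ right_invariant m.

Definition amenable (K : numFieldType) (T : semitopSemigroupType) : Prop :=
  exists m : {scalar bcfun K T},
    is_mean m /\ right_invariant m /\ left_invariant m.

Section bounded_operators.
Context (K : numFieldType) (X : normedModType K).

Definition bop_pred : {pred X -> X} := [pred A : X -> X |
  `[< linear A /\ exists M : K, forall x, `|A x| <= M * `|x| >]].

Lemma bop_submod_closed : submod_closed bop_pred.
Proof.
split.
  apply/asboolP; split; last by exists 0 => x; rewrite normr0 mul0r.
  by move=> a x y; rewrite scaler0 addr0.
move=> a A B /asboolP[lA [M AM]] /asboolP[lB [N BN]]; apply/asboolP; split.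
  move=> b x y.
  rewrite -[LHS]/(a *: A (b *: x + y) + B (b *: x + y)) lA lB.
  rewrite -[RHS]/(b *: (a *: A x + B x) + (a *: A y + B y)).
  by rewrite !scalerDr !scalerA [a * b]mulrC addrACA.
exists (`|a| * M + N) => x.
rewrite (le_trans (ler_normD _ _))// mulrDl lerD//.
by rewrite normrZ -mulrA ler_wpM2l.
Qed.

HB.instance Definition _ :=
  GRing.isSubmodClosed.Build _ _ bop_pred bop_submod_closed.

Record bop := BOp { bop_fun :> X -> X ; bop_mem : bop_fun \in bop_pred }.

HB.instance Definition _ := [isSub for bop_fun].
HB.instance Definition _ := [Choice of bop by <:].
HB.instance Definition _ := [SubChoice_isSubLmodule of bop by <:].

(* The strong operator topology. *)
HB.instance Definition _ :=
  Topological.copy bop (initial_topology (bop_fun : bop -> {ptws X -> X})).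

Lemma bopP (A : bop) :
  linear A /\ exists M : K, forall x, `|A x| <= M * `|x|.
Proof. exact/asboolP/bop_mem. Qed.

Lemma bop_comp_subproof (A B : bop) : A \o B \in bop_pred.
Proof.
have [lA [M AM]] := bopP A; have [lB [N BN]] := bopP B.
apply/asboolP; split; first by move=> a x y /=; rewrite lB lA.
exists (`|M| * N) => x /=; rewrite (le_trans (AM _))//.
have [->|Bx0] := eqVneq (B x) 0.
  rewrite normr0 mulr0 -mulrA mulr_ge0//.
  exact: le_trans (BN x).
rewrite -mulrA (@le_trans _ _ (`|M| * `|B x|))// ?ler_wpM2l//.
apply: ler_wpM2r => //; apply: real_ler_norm.
have Mge0 : 0 <= M.
  by rewrite -(pmulr_lge0 _ (_ : 0 < `|B x|)) ?normr_gt0// (le_trans _ (AM _)).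
exact: ger0_real.
Qed.

Definition bop_comp (A B : bop) : bop := BOp (bop_comp_subproof A B).

Lemma bop_continuous (A : bop) : continuous A.
Proof.
have [lA [M AM]] := bopP A.
pose A' : {linear X -> X} := HB.pack (A : X -> X) (GRing.isLinear.Build _ _ _ _ _ lA).
apply: (@bounded_linear_continuous _ _ _ A').
apply/ex_bound; exists `|M|; apply/nbhs_norm0P; exists 1 => //= x /= x1.
have [->|x0] := eqVneq x 0.
  by rewrite -[A 0]/(A' 0) linear0 normr0.
have Mge0 : 0 <= M.
  by rewrite -(pmulr_lge0 _ (_ : 0 < `|x|)) ?normr_gt0// (le_trans _ (AM _)).
by rewrite ger0_norm// (le_trans (AM _))// ler_piMr// ltW.
Qed.

Lemma bop_cvgP (F : set_system bop) (A : bop) : Filter F ->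
  F --> A <-> forall x, (fun B : bop => B x) @ F --> A x.
Proof.
move=> FF.
pose G : set_system {ptws X -> X} := (bop_fun : bop -> {ptws X -> X}) @ F.
have FG : Filter G by exact: fmap_filter.
suff -> : F --> A <-> G --> (A : {ptws X -> X}).
  split.
    by move=> GA x; move/(@pointwise_cvgP _ _ _ _ _) : GA; apply.
  by move=> h; apply/(@pointwise_cvgP _ _ _ _ _) => x; exact: h.
split=> [FA U UA|GA U].
  apply: FA; exact: (@initial_continuous bop {ptws X -> X} bop_fun A U UA).
move=> [_ [[B Bop <-] BA BU]]; apply: filterS BU _.
by apply: (GA B); exact: open_nbhs_nbhs.
Qed.

Definition convex_hull (S : set bop) : set bop :=
  \bigcap_(C in [set C : set bop |
                  convex_set (C : set (convex_lmodType bop)) /\ S `<=` C]) C.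

End bounded_operators.

Section representations.
Context (K : numFieldType) (X : normedModType K) (G : semitopSemigroupType).

Record bounded_representation := BoundedRepresentation {
  rep_op :> G -> bop X ;
  rep_bounded : exists M : K, forall g x, `|rep_op g x| <= M * `|x| ;
  (* The order of the factors is reversed. *)
  rep_comp : forall g h, bop_comp (rep_op g) (rep_op h) = rep_op (h * g)%g ;
  rep_continuous : forall x, continuous (fun g => rep_op g x)
}.

(* The set {S_g : g in G}, as a type of its own carrying the topology induced by
   the strong operator topology and the composition of operators. *)
Definition rep_semigroup (S : bounded_representation) : Type :=
  set_type (range S).

Variable S : bounded_representation.
Local Notation TS := (rep_semigroup S).

HB.instance Definition _ := Topological.copy TS (set_type (range S)).

Lemma rep_mul_subproof (s t : TS) : bop_comp (val s) (val t) \in range S.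
Proof.
case: s t => [_ /= /set_mem[g _ <-]] [_ /= /set_mem[h _ <-]].
by apply/mem_set; exists (h * g)%g => //; rewrite rep_comp.
Qed.

Definition rep_mul (s t : TS) : TS :=
  exist _ (bop_comp (val s) (val t)) (rep_mul_subproof s t).

Lemma rep_mulA : associative rep_mul.
Proof. by move=> s t u; apply/val_inj/val_inj. Qed.

HB.instance Definition _ := isSemigroup.Build TS rep_mulA.

Lemma rep_cvgP (F : set_system TS) (s : TS) : Filter F ->
  F --> s <-> forall x, (fun t : TS => val t x) @ F --> val s x.
Proof.
move=> FF; pose H : set_system (bop X) := (fun t : TS => val t) @ F.
have FH : Filter H by exact: fmap_filter.
suff -> : F --> s <-> H --> val s by exact: bop_cvgP.
split=> [Fs U UA|Hs U].
  by apply: Fs; exact: (@initial_continuous TS (bop X) (fun t => val t) s U UA).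
move=> [_ [[B Bop <-] BA BU]]; apply: filterS BU _.
by apply: (Hs B); exact: open_nbhs_nbhs.
Qed.

Lemma rep_eval_continuous (x : X) : continuous (fun t : TS => val t x).
Proof. by move=> t; apply: (rep_cvgP _ _).1 (@cvg_id _ (nbhs t)) x. Qed.

Lemma rep_mul_continuousl (s : TS) : continuous (fun t : TS => (s * t)%g).
Proof.
move=> t.
have FF : Filter ((s * u)%g @[u --> t]).
  apply: fmap_filter; exact: nbhs_filter.
apply/(rep_cvgP _ FF) => x.
apply: (@continuous_comp _ _ _ (fun u : TS => val u x) (val s)).
  exact: rep_eval_continuous.
exact: bop_continuous.
Qed.

Lemma rep_mul_continuousr (s : TS) : continuous (fun t : TS => (t * s)%g).
Proof.
move=> t.
have FF : Filter ((u * s)%g @[u --> t]).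
  apply: fmap_filter; exact: nbhs_filter.
apply/(rep_cvgP _ FF) => x.
exact: (@rep_eval_continuous (val s x)).
Qed.

HB.instance Definition _ := isSeparatelyContinuous.Build TS
  rep_mul_continuousl rep_mul_continuousr.

End representations.

Definition directed_set (I : Type) (le : I -> I -> Prop) : Prop :=
  [/\ inhabited I,
      forall i, le i i,
      forall i j k, le i j -> le j k -> le i k &
      forall i j, exists k, le i k /\ le j k].

(* Convergence of a net u on I is convergence of u along this filter. *)
Definition tails (I : Type) (le : I -> I -> Prop) : set_system I :=
  [set P | exists i0, forall i, le i0 i -> P i].

Section ergodic_nets.
Context (K : numFieldType) (X : normedModType K) (G : semitopSemigroupType).
Context (S : bounded_representation X G).
Context (I : Type) (le : I -> I -> Prop) (A : I -> bop X).

Definition strong_right_ergodic_net : Prop :=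
  [/\ directed_set le,
      forall i, closure (convex_hull (range S)) (A i) &
      forall x g, A i x - A i (S g x) @[i --> tails le] --> (0 : X)].

Definition strong_left_ergodic_net : Prop :=
  [/\ directed_set le,
      forall i, closure (convex_hull (range S)) (A i) &
      forall x g, A i x - S g (A i x) @[i --> tails le] --> (0 : X)].

Definition strong_ergodic_net : Prop :=
  strong_right_ergodic_net /\ strong_left_ergodic_net.

End ergodic_nets.

(* Main.v *)
Require Import Defs.
From HB Require Import structures.
From mathcomp Require Import all_boot all_order all_algebra.
From mathcomp Require Import complex.
From mathcomp Require Import all_classical all_reals all_analysis.
From mathcomp Require Import lra.

(** Suppose that there were finitely many points x_i, elements g_i of G and a
    number e > 0 such that no operator A in the convex hull of S made all the
    vectors A x_i - A (S g_i x_i) and A x_i - S g_i (A x_i) smaller than e.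
    Collect these vectors into one vector Phi(A) of a finite power of X.  Since
    Phi is linear, Phi maps the convex hull to a convex set at positive
    distance from 0, and the Hahn-Banach theorem yields a continuous
    real-linear functional u with u >= e on this set.  Now u is a sum of
    functionals phi on X, one per component, so s |-> u (Phi(s)) is a sum of
    functions on the semigroup S of the form f - R_t f or f - L_t f, where
    f(s) = phi (s x) is bounded and continuous.  An invariant mean vanishes on
    such a sum, but it cannot vanish on a function that is everywhere at least
    e > 0.

    Hence every finite set of conditions can be met up to every tolerance within
    the convex hull itself, and such choices, indexed by the pairs of a finite
    set and a tolerance, form the ergodic net.  With right invariance only, the
    same argument applies to the vectors A x_i - A (S g_i x_i) alone.

    The separation step is proved through the theorem of Mazur and Orlicz
    ([mazur_orlicz]), itself a consequence of the domination form of the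
    Hahn-Banach theorem ([hahn_banach]); there the linear functional is obtained
    as a minimal sublinear functional.  Only the real-linear structure of X
    matters for separation: a real-valued functional still defines a
    scalar-valued function on S, to which the mean applies.  So complex spaces
    are treated by restricting the scalars, and no complex functional is ever
    formed.  The contradiction is derived in [tests_small_on_convex_hull]. *)

Set Implicit Arguments.
Unset Strict Implicit.
Unset Printing Implicit Defensive.

Import Order.TTheory GRing.Theory Num.Theory.
Import numFieldNormedType.Exports.

Local Open Scope classical_set_scope.
Local Open Scope ring_scope.

(** * Sublinear functionals and the Mazur-Orlicz theorem *)

Section sublinear_functionals.
Context (R : realType) (V : lmodType R).
Implicit Types (p q : V -> R) (D : V -> R -> Prop).

(** Inequality in the homogeneity clause suffices: applied to the inverse
    scalar it yields the reverse inequality. *)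
Definition sublinear p : Prop :=
  (forall x y, p (x + y) <= p x + p y) /\
  (forall r x, 0 <= r -> p (r *: x) <= r * p x).

Lemma sublinear_ge0 p x : sublinear p -> 0 <= p x + p (- x).
Proof.
move=> [pD _]; have := pD x (- x); rewrite subrr => p0.
by have := pD 0 0; rewrite addr0; lra.
Qed.

Lemma sublinearZ p r x : sublinear p -> 0 <= r -> p (r *: x) = r * p x.
Proof.
move=> subp; have [pD pZ] := subp; rewrite le_eqVlt => /predU1P[<-|r0].
  have := pZ 0 x (lexx 0); have := sublinear_ge0 0 subp.
  by rewrite oppr0 scale0r; lra.
apply/eqP; rewrite eq_le pZ ?(ltW r0)//=.
rewrite mulrC -ler_pdivlMr// mulrC.
have := pZ r^-1 (r *: x); rewrite scalerA mulVf ?gt_eqF// scale1r.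
by apply; rewrite invr_ge0 ltW.
Qed.

(** The two constructions of sublinear functionals below are both pointwise
    infima; this isolates the part of the argument that they share. *)
Lemma sublinear_inf (E : V -> set R) :
  (forall x, has_inf (E x)) ->
  (forall x y a b, E x a -> E y b -> exists2 c, E (x + y) c & c <= a + b) ->
  (forall r x a, 0 <= r -> E x a -> exists2 c, E (r *: x) c & c <= r * a) ->
  sublinear (fun x => inf (E x)).
Proof.
move=> hE ED EZ; split=> [x y|r x r0].
  rewrite -inf_sumE//; apply: lb_le_inf.
    have [[a Ea] _] := hE x; have [[b Eb] _] := hE y.
    by exists (a + b); exists a => //; exists b.
  move=> _ [a Ea [b Eb <-]]; have [c Ec cab] := ED _ _ _ _ Ea Eb.
  by apply: le_trans cab; apply: ge_inf => //; exact: (hE _).2.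
have inf_le a : E x a -> inf (E (r *: x)) <= r * a.
  move=> Ea; have [c Ec ca] := EZ _ _ _ r0 Ea.
  by apply: le_trans ca; apply: ge_inf => //; exact: (hE _).2.
case: (eqVneq r 0) inf_le => [-> inf_le|rN0 inf_le].
  by have [[a Ea] _] := hE x; have := inf_le _ Ea; rewrite !mul0r.
have r_gt0 : 0 < r by rewrite lt_def rN0.
rewrite mulrC -ler_pdivrMr//; apply: lb_le_inf; first exact: (hE x).1.
by move=> a Ea; rewrite ler_pdivrMr// mulrC inf_le.
Qed.

(** A pair (w, s) in D stands for the requirement that a linear functional be
    at least s at w.  Such requirements can be added and scaled by nonnegative
    numbers, and only those with s <= p w can be met below p. *)
Definition requirement_cone p D : Prop :=
  [/\ D 0 0,
      forall w s w' s', D w s -> D w' s' -> D (w + w') (s + s'),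
      forall r w s, 0 <= r -> D w s -> D (r *: w) (r * s) &
      forall w s, D w s -> s <= p w].

(** The largest sublinear functional below p whose value at -w is at most -s
    for every requirement (w, s); any linear functional below it meets all
    the requirements. *)
Definition lowered p D : V -> R :=
  fun x => inf [set p (x + ws.1) - ws.2 | ws in [set ws | D ws.1 ws.2]].

Lemma loweredP p D : sublinear p -> requirement_cone p D ->
  [/\ sublinear (lowered p D), forall x, lowered p D x <= p x &
      forall w s, D w s -> lowered p D (- w) <= - s].
Proof.
move=> subp [D0 DD DZ Dp]; have [pD pZ] := subp.
have hE x : has_inf [set p (x + ws.1) - ws.2 | ws in [set ws | D ws.1 ws.2]].
  split; first by exists (p (x + 0) - 0); exists (0, 0).
  exists (- p (- x)) => _ [[w s] /= Dws <-].
  have := pD (x + w) (- x); rewrite addrAC subrr add0r; have := Dp _ _ Dws.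
  by lra.
have le x w s : D w s -> lowered p D x <= p (x + w) - s.
  by move=> Dws; apply: ge_inf; [exact: (hE x).2|exists (w, s)].
split=> [|x|w s Dws]; first apply: sublinear_inf => //.
- move=> x y _ _ [[w s] /= Dws <-] [[w' s'] /= Dws' <-].
  exists (p (x + y + (w + w')) - (s + s')).
    by exists (w + w', s + s') => //; exact: DD.
  by rewrite addrACA; have := pD (x + w) (y + w'); lra.
- move=> r x _ r0 [[w s] /= Dws <-].
  exists (p (r *: x + r *: w) - r * s).
    by exists (r *: w, r * s) => //; exact: DZ.
  by rewrite -scalerDr mulrBr; have := pZ r (x + w) r0; lra.
- by have := le x 0 0 D0; rewrite addr0 subr0.
- have := le (- w) w s Dws; rewrite addNr.
  by have := pZ 0 0 (lexx 0); rewrite scaler0 mul0r; lra.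
Qed.

(** A sublinear functional that is minimal among the sublinear functionals is
    linear: lowering it by the requirement that the value at y be the one it
    already has changes nothing, so its value at -y is minus its value at y. *)
Lemma minimal_sublinear_linear q : sublinear q ->
  (forall q', sublinear q' -> (forall x, q' x <= q x) -> q' = q) -> scalar q.
Proof.
move=> subq qmin; have [qD qZ] := subq.
have qN y : q (- y) = - q y.
  apply/eqP; rewrite eq_le; apply/andP; split; last first.
    by have := sublinear_ge0 y subq; lra.
  (* The ray of requirements generated by (y, q y). *)
  pose D w s := exists2 t, 0 <= t & w = t *: y /\ s = t * q y.
  have [|subD leD DN] := @loweredP q D subq.
    split.
    - by exists 0 => //; rewrite scale0r mul0r.
    - move=> w s w' s' [t t0 [-> ->]] [t' t0' [-> ->]].
      by exists (t + t'); rewrite ?addr_ge0// scalerDl mulrDl.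
    - move=> r w s r0 [t t0 [-> ->]].
      by exists (r * t); rewrite ?mulr_ge0// scalerA mulrA.
    - by move=> w s [t t0 [-> ->]]; rewrite sublinearZ.
  have := DN y (q y); rewrite (qmin _ subD leD); apply.
  by exists 1; rewrite // scale1r mul1r.
have qDE x y : q (x + y) = q x + q y.
  apply/eqP; rewrite eq_le qD/=.
  by have := qD (x + y) (- y); rewrite addrK qN; lra.
move=> r x y; rewrite qDE; congr (_ + _).
have [r0|/ltW r0] := leP 0 r; first exact: sublinearZ.
by rewrite -[r *: x]opprK -scaleNr qN sublinearZ ?oppr_ge0// mulNr opprK.
Qed.

(** Zorn's lemma gives a minimal sublinear functional below p: the infimum of
    a chain of sublinear functionals is sublinear since, of two members of the
    chain, the smaller one bounds the infimum at a sum of two vectors. *)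
Theorem hahn_banach p : sublinear p ->
  exists u : {scalar V}, forall x, u x <= p x.
Proof.
move=> subp; pose below q := sublinear q /\ forall x, q x <= p x.
pose T := {q | below q}.
pose ge (q q' : T) := `[< forall x, sval q' x <= sval q x >].
have [||||[q [subq qp]] qmin] := @Zorn T ge.
- by move=> q; apply/asboolP.
- move=> q q' q'' /asboolP qq' /asboolP qq''; apply/asboolP => x.
  exact: le_trans (qq'' x) (qq' x).
- move=> [q Pq] [q' Pq'] /asboolP/= qq' /asboolP/= q'q.
  apply: eq_exist; apply/funext => x; apply/eqP.
  by rewrite eq_le q'q qq'.
- move=> A totA; have [[q0 Aq0]|A0] := pselect (A !=set0); last first.
    have Pp : below p by [].
    by exists (exist _ p Pp) => s As; case: A0; exists s.
  pose E x := [set sval q x | q in A].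
  have hE x : has_inf (E x).
    split; first by exists (sval q0 x); exists q0.
    exists (- p (- x)) => _ [[q [subq qp]] /= _ <-].
    by have := qp (- x); have := sublinear_ge0 x subq; lra.
  have subE : sublinear (fun x => inf (E x)).
    apply: sublinear_inf => // [x y _ _ [q Aq <-] [q' Aq' <-]|
                                r x _ r0 [q Aq <-]].
      have qD (s : T) : sval s (x + y) <= sval s x + sval s y.
        exact: (svalP s).1.1.
      have [/asboolP qq'|/asboolP qq'] := totA _ _ Aq Aq'.
        exists (sval q' (x + y)); first by exists q'.
        by rewrite (le_trans (qD _))// lerD2r qq'.
      exists (sval q (x + y)); first by exists q.
      by rewrite (le_trans (qD _))// lerD2l qq'.
    by exists (sval q (r *: x)); [exists q|exact: (svalP q).1.2].
  have infE (q : T) x : A q -> inf (E x) <= sval q x.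
    by move=> Aq; apply: ge_inf; [exact: (hE x).2|exists q].
  have PE : below (fun x => inf (E x)).
    by split=> // x; apply: le_trans (infE q0 x Aq0) ((svalP q0).2 x).
  by exists (exist _ _ PE) => q Aq; apply/asboolP => x; exact: infE.
have linq : scalar q.
  apply: minimal_sublinear_linear => // q' subq' q'q.
  have Pq' : below q' by split=> // x; apply: le_trans (qp x).
  by have /(congr1 sval) := qmin (exist _ q' Pq') (asboolT q'q).
pose u : {scalar V} := HB.pack q (GRing.isLinear.Build _ _ _ _ q linq).
by exists u.
Qed.

(** Lowering p first forces the functional obtained below it to meet the
    requirements. *)
Theorem mazur_orlicz p D : sublinear p -> requirement_cone p D ->
  exists2 u : {scalar V},
    forall x, u x <= p x & forall w s, D w s -> s <= u w.
Proof.
move=> subp coneD; have [subD leD DN] := loweredP subp coneD.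
have [u uD] := hahn_banach subD; exists u => [x|w s Dws].
  exact: le_trans (uD x) (leD x).
by have := le_trans (uD (- w)) (DN _ _ Dws); rewrite linearN lerN2.
Qed.

End sublinear_functionals.

(** * Real scalars inside real or complex scalars *)

Section real_scalars.
Context (R : realType) (k : scalar_kind).
Local Notation K := (scalars R k).

Definition of_real : {rmorphism R -> K} :=
  match k return {rmorphism R -> scalars R k} with
  | RealScalars => idfun
  | ComplexScalars => real_complex R
  end.

(** Meaningful on norms, which are nonnegative and hence real scalars. *)
Definition to_real : K -> R :=
  match k return scalars R k -> R with
  | RealScalars => idfun
  | ComplexScalars => fun z => complex.Re z
  end.

Lemma of_real_le : {mono of_real : r s / r <= s}.
Proof.
rewrite /of_real; case: k => //= r s.
by rewrite lecE /= eqxx.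
Qed.

Lemma of_realK : cancel of_real to_real.
Proof. by rewrite /of_real /to_real; case: k. Qed.

Lemma to_realK z : 0 <= z -> of_real (to_real z) = z.
Proof.
rewrite /of_real /to_real; case: k z => //= -[a b].
by rewrite lecE /= => /andP[/eqP-> _].
Qed.

Lemma of_real_lt : {mono of_real : r s / r < s}.
Proof. exact/leW_mono/of_real_le. Qed.

Lemma to_real_ge0 z : 0 <= z -> 0 <= to_real z.
Proof. by move=> z0; rewrite -of_real_le rmorph0 to_realK. Qed.

Lemma of_real_norm r : `|of_real r| = of_real `|r|.
Proof.
have le0 s : (0 <= of_real s) = (0 <= s).
  by rewrite -[X in X <= of_real _](rmorph0 of_real) of_real_le.
have [r0|/ltW r0] := leP 0 r; first by rewrite !ger0_norm ?le0.
by rewrite -normrN -rmorphN ger0_norm ?le0 ?oppr_ge0// ler0_norm.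
Qed.

Lemma to_real_le z z' : 0 <= z -> z <= z' -> to_real z <= to_real z'.
Proof.
move=> z0 zz'; rewrite -of_real_le !to_realK//; exact: le_trans zz'.
Qed.

Lemma to_realD z z' : 0 <= z -> 0 <= z' ->
  to_real (z + z') = to_real z + to_real z'.
Proof.
move=> z0 z'0.
by rewrite -{1}(to_realK z0) -{1}(to_realK z'0) -rmorphD of_realK.
Qed.

Lemma to_realM r z : 0 <= z -> to_real (of_real r * z) = r * to_real z.
Proof. by move=> z0; rewrite -{1}(to_realK z0) -rmorphM of_realK. Qed.

End real_scalars.

(** Restriction of scalars; the alias carries the real module structure, so that
    it does not compete with the original one on V. *)
Definition realification (R : realType) (k : scalar_kind)
  (V : lmodType (scalars R k)) : Type := V.

Section realification.
Context (R : realType) (k : scalar_kind) (V : lmodType (scalars R k)).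

HB.instance Definition _ := GRing.Zmodule.copy (realification V) V.

Definition real_scale (r : R) (v : realification V) : realification V :=
  of_real R k r *: (v : V).

Lemma real_scaleA r s v : real_scale r (real_scale s v) = real_scale (r * s) v.
Proof. by rewrite /real_scale scalerA rmorphM. Qed.

Lemma real_scale1 : left_id 1 real_scale.
Proof. by move=> v; rewrite /real_scale rmorph1 scale1r. Qed.

Lemma real_scaleDr : right_distributive real_scale +%R.
Proof. by move=> r v w; rewrite /real_scale scalerDr. Qed.

Lemma real_scaleDl v : {morph real_scale^~ v : r s / r + s}.
Proof. by move=> r s; rewrite /real_scale rmorphD scalerDl. Qed.

HB.instance Definition _ := GRing.Zmodule_isLmodule.Build R (realification V)
  real_scaleA real_scale1 real_scaleDr real_scaleDl.

End realification.

(** * Means *)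

Section means.
Context (K : numFieldType) (T : topologicalType).

(** On an empty space the constant 1 is 0, and no functional maps 0 to 1. *)
Lemma mean_inhabited (m : {scalar bcfun K T}) : is_mean m -> inhabited T.
Proof.
move=> [m1 _]; have [[t _]|T0] := pselect ([set: T] !=set0).
  exact: inhabits.
have : bcfun1 K T = 0.
  by apply/val_inj/funext => t; case: T0; exists t.
by move=> e; move: m1; rewrite e linear0 => /eqP; rewrite eq_sym oner_eq0.
Qed.

(** If e <= f <= M, the function (M + e - f) / M takes values between e / M and
    1, so that m has absolute value at most 1 at it; were m f = 0, that value
    would be 1 + e / M. *)
Lemma mean_neq0 (m : {scalar bcfun K T}) (f : bcfun K T) (e : K) :
  is_mean m -> 0 < e -> (forall t, e <= f t) -> m f <> 0.
Proof.
move=> mm e0 ef mf; have [t0] := mean_inhabited mm; have [m1 [mle _]] := mm.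
have [[M fM] _] := bcfunP f.
have fge0 t : 0 <= f t by apply: le_trans (ef t); exact: ltW.
have f_le t : f t <= M by rewrite -[f t]ger0_norm.
have M0 : 0 < M by rewrite (lt_le_trans e0)// (le_trans (ef t0)).
pose h := ((M + e) / M) *: bcfun1 K T - M^-1 *: f.
have mh : m h = 1 + e / M.
  rewrite linearB/= [m (_ *: f)]linearZ_LR [m (_ *: _)]linearZ_LR mf m1.
  rewrite mulr1 mulr0 subr0 mulrDl.
  by rewrite divff// gt_eqF.
have hball : bcfun_unit_ball h.
  move=> t; have -> : h t = (M + e - f t) / M.
    rewrite -[h t]/((M + e) / M * 1 - M^-1 * f t) mulr1 mulrBl.
    by rewrite [f t / M]mulrC.
  rewrite ger0_norm; last first.
    by rewrite divr_ge0 ?(ltW M0)// subr_ge0 (le_trans (f_le t))// lerDl ltW.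
  by rewrite ler_pdivrMr// mul1r lerBlDr lerD2l.
have /mle : [set `|m f| | f in @bcfun_unit_ball K T] `|m h| by exists h.
rewrite mh ger0_norm ?addr_ge0 ?divr_ge0 ?(ltW e0) ?(ltW M0)//.
by rewrite gerDl => /(lt_le_trans (divr_gt0 e0 M0)); rewrite ltxx.
Qed.

End means.

(** * Operators in the convex hull on which finitely many tests are small *)

(** The cone over a convex hull is closed under addition: a combination with
    weights s and t is s + t times the convex combination with weights
    s / (s + t) and t / (s + t). *)
Lemma convex_hull_cone (K : numFieldType) (X : normedModType K)
    (C : set (bop X)) (A B : bop X) (s t : K) :
  convex_hull C A -> convex_hull C B -> 0 <= s -> 0 <= t -> 0 < s + t ->
  exists2 D, convex_hull C D & s *: A + t *: B = (s + t) *: D.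
Proof.
move=> CA CB s0 t0 st0; have stN0 : s + t != 0 by rewrite gt_eqF.
have l0 : 0 <= s / (s + t) by rewrite divr_ge0// ltW.
have l1 : s / (s + t) <= 1 by rewrite ler_pdivrMr// mul1r lerDl.
pose l := Itv01 l0 l1.
exists ((s / (s + t)) *: A + (1 - s / (s + t)) *: B); last first.
  rewrite scalerDr !scalerA mulrBr mulr1 mulrCA divff// mulr1.
  by rewrite [s + t]addrC addrK.
move=> H [convH CH].
have /set_mem := convH A B l (mem_set (CA H (conj convH CH)))
  (mem_set (CB H (conj convH CH))).
exact.
Qed.

Section tests.
Context (R : realType) (k : scalar_kind) (X : normedModType (scalars R k)).
Context (G : semitopSemigroupType) (S : bounded_representation X G).
Local Notation K := (scalars R k).
Local Notation TS := (rep_semigroup S).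
Local Notation of_real := (of_real R k).
Local Notation to_real := (@to_real R k).

(** The unit ball of the real dual; the bound at -y makes the one-sided
    condition two-sided. *)
Definition dual_ball : set {scalar realification X} :=
  [set phi | forall y : X, phi y <= to_real `|y|].

Lemma dual_ball_norm phi (y : X) : dual_ball phi -> `|of_real (phi y)| <= `|y|.
Proof.
move=> phi1; rewrite of_real_norm -[leRHS]to_realK// of_real_le ler_norml phi1.
rewrite andbT lerNl; have := phi1 (- y).
by rewrite normrN [phi (- y)]linearN.
Qed.

Lemma dual_ball_continuous phi : dual_ball phi ->
  continuous (fun y : X => of_real (phi y) : K^o).
Proof.
move=> phi1 y; apply/cvgrPdist_lt => e e0; near=> z.
rewrite -rmorphB -[phi y - phi z](linearB phi).
apply: (le_lt_trans (dual_ball_norm _ phi1)).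
by near: z; apply: cvgr_dist_lt => //; exact: cvg_id.
Unshelve. all: by end_near. Qed.

(** Boundedness comes from that of the representation, continuity from the
    topology being the strong one. *)
Lemma orbit_fun_subproof phi (x : X) : dual_ball phi ->
  (fun s : TS => of_real (phi (val s x))) \in @bcfun_pred K TS.
Proof.
move=> phi1; apply/asboolP; split.
  have [M SM] := rep_bounded S; exists (M * `|x|) => -[A /= /set_mem[g _ <-]].
  exact: le_trans (dual_ball_norm _ phi1) (SM g x).
move=> s.
apply: (@continuous_comp _ _ _ (fun t : TS => val t x)
  (fun y : X => of_real (phi y) : K^o)).
  exact: rep_eval_continuous.
exact: dual_ball_continuous.
Qed.

Definition orbit_fun phi (x : X) (phi1 : dual_ball phi) : bcfun K TS :=
  BCFun (orbit_fun_subproof x phi1).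

(** This property of a test D is all that the convexity argument needs to know
    about the invariance of m: composed with a functional of the dual ball, D
    restricts to a bounded continuous function on S whose mean is 0. *)
Definition annihilated (m : {scalar bcfun K TS}) (D : bop X -> X) : Prop :=
  linear D /\ forall phi, dual_ball phi ->
    exists2 f : bcfun K TS, forall s, f s = of_real (phi (D (val s))) & m f = 0.

(** On the semigroup S, evaluating s (S g x) means translating the orbit
    function of x on the right by S g, which a right invariant mean does not
    notice. *)
Lemma right_test_annihilated m x g : right_invariant m ->
  annihilated m (fun A => A x - A (S g x)).
Proof.
move=> rm; split=> [a A B|phi phi1].
  rewrite -[LHS]/(a *: A x + B x - (a *: A (S g x) + B (S g x))).
  by rewrite scalerBr opprD addrACA.
have Sg : S g \in range S by apply/mem_set; exists g.
pose t : TS := exist _ (S g) Sg.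
exists (orbit_fun x phi1 - rtranslate t (orbit_fun x phi1)) => [s|].
  by rewrite [phi _](linearB phi) rmorphB.
by rewrite linearB/= rm subrr.
Qed.

(** Likewise, S g (s x) is the value of the orbit of x at the left translate of
    s by S g. *)
Lemma left_test_annihilated m x g : left_invariant m ->
  annihilated m (fun A => A x - S g (A x)).
Proof.
move=> lm; split=> [a A B|phi phi1].
  rewrite -[LHS]/(a *: A x + B x - S g (a *: A x + B x)).
  by rewrite (bopP (S g)).1 scalerBr opprD addrACA.
have Sg : S g \in range S by apply/mem_set; exists g.
pose t : TS := exist _ (S g) Sg.
exists (orbit_fun x phi1 - ltranslate t (orbit_fun x phi1)) => [s|].
  by rewrite [phi _](linearB phi) rmorphB.
by rewrite linearB/= lm subrr.
Qed.

(** If e <= p (Phi A) for all A in the convex hull, where p is the sum of the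
    norms of the components and Phi A the vector of all the D i A, the
    Mazur-Orlicz theorem gives a real-linear u below p with u (Phi A) >= e.
    Being below p, u restricts to a functional of the dual ball on each
    component, so the mean of s |-> u (Phi s) >= e is a sum of zeros. *)
Lemma tests_small_on_convex_hull (I : finType) (D : I -> bop X -> X) m (e : R) :
  is_mean m -> (forall i, annihilated m (D i)) -> 0 < e ->
  exists2 A, convex_hull (range S) A & forall i, to_real `|D i A| < e.
Proof.
move=> mm Dm e0; apply: contrapT => noA.
pose V := realification {ffun I -> X}.
pose p (v : V) : R := \sum_i to_real `|(v : {ffun I -> X}) i|.
pose Phi A : V := [ffun i => D i A].
have subp : sublinear p.
  split=> [v w|r v r0].
    rewrite -big_split/= ler_sum// => i _.
    by rewrite -to_realD// to_real_le// ffunE ler_normD.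
  rewrite mulr_sumr ler_sum// => i _.
  by rewrite ffunE normrZ of_real_norm to_realM// ger0_norm.
have p_ge A : convex_hull (range S) A -> e <= p (Phi A).
  move=> hA; rewrite leNgt; apply/negP => pA; apply: noA; exists A => // i.
  apply: le_lt_trans pA; rewrite /p (bigD1 i)//= ffunE lerDl.
  by apply: sumr_ge0 => j _; exact: to_real_ge0.
have PhiL A B t t' :
    t *: Phi A + t' *: Phi B = Phi (of_real t *: A + of_real t' *: B).
  apply/ffunP => i; pose Di : {linear bop X -> X} :=
    HB.pack (D i) (GRing.isLinear.Build _ _ _ _ _ (Dm i).1).
  by rewrite !ffunE [RHS](linearP Di) [Di (_ *: _)]linearZ.
have [[A0 /= /set_mem[g0 _ _]]] := mean_inhabited mm.
have hS g : convex_hull (range S) (S g) by move=> H [_ HS]; apply: HS; exists g.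
(* The requirements u (Phi A) >= e, closed under nonnegative scaling. *)
pose Q (w : V) (s : R) := exists t A,
  [/\ 0 <= t, convex_hull (range S) A, w = t *: Phi A & s = t * e].
have coneQ : requirement_cone p Q.
  split.
  - by exists 0, (S g0); split=> //; rewrite ?scale0r ?mul0r.
  - move=> _ _ _ _ [t [A [t0 hA -> ->]]] [t' [A' [t'0 hA' -> ->]]].
    (* If both weights are 0, no normalized combination exists. *)
    have [tt'|tt'0] := leP (t + t') 0.
      have [-> ->] : t = 0 /\ t' = 0 by split; lra.
      by exists 0, A; split=> //; rewrite ?mul0r ?addr0// !scale0r addr0.
    have K0 r : 0 <= r -> 0 <= of_real r.
      by rewrite -(rmorph0 of_real) of_real_le.
    have [||| B hB AB] :=
      convex_hull_cone (s := of_real t) (t := of_real t') hA hA'.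
    + exact: K0.
    + exact: K0.
    + by rewrite -rmorphD -(rmorph0 of_real) of_real_lt.
    exists (t + t'), B.
    split=> //; [exact: addr_ge0| |by rewrite mulrDl].
    (* PhiL only speaks of sums of two terms: pad with 0 times Phi A. *)
    rewrite PhiL AB -rmorphD -[in LHS](addr0 (_ *: B)) -(scale0r A).
    by rewrite -(rmorph0 of_real) -PhiL scale0r addr0.
  - move=> r _ _ r0 [t [A [t0 hA -> ->]]]; exists (r * t), A.
    by rewrite scalerA mulrA mulr_ge0.
  - move=> _ _ [t [A [t0 hA -> ->]]].
    by rewrite sublinearZ// ler_wpM2l// p_ge.
have [u up uQ] := mazur_orlicz subp coneQ.
pose ins i (y : X) : V := [ffun j => if j == i then y else 0].
have /choice[phi phiP] i : exists phi : {scalar realification X},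
    dual_ball phi /\ forall y, phi y = u (ins i y).
  have lin_phi : scalar (fun y : realification X => u (ins i y)).
    move=> r y z; rewrite -linearP; congr (u _); apply/ffunP => j.
    by rewrite !ffunE; case: ifP => // _; rewrite scaler0 addr0.
  pose phi : {scalar realification X} := HB.pack
    (fun y : realification X => u (ins i y))
    (GRing.isLinear.Build _ _ _ _ _ lin_phi).
  exists phi; split=> // y; apply: le_trans (up _) _.
  rewrite /p (bigD1 i)//= ffunE eqxx big1 ?addr0// => j /negPf ji.
  by rewrite ffunE ji normr0 -(rmorph0 of_real) of_realK.
have /choice[f fP] i : exists f : bcfun K TS,
    (forall s, f s = of_real (phi i (D i (val s)))) /\ m f = 0.
  by have [f] := (Dm i).2 _ (phiP i).1; exists f.
have me : m (\sum_i f i) <> 0.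
  apply: (@mean_neq0 K TS m _ (of_real e)) => // [|s].
    by rewrite -(rmorph0 of_real) of_real_lt.
  rewrite (big_morph (fun h : bcfun K TS => h s) (id1 := 0) (op1 := +%R))//.
  rewrite (eq_bigr (fun i => of_real (u (ins i (D i (val s)))))); last first.
    by move=> i _; rewrite (fP i).1 (phiP i).2.
  rewrite -rmorph_sum -linear_sum of_real_le.
  have -> : \sum_i ins i (D i (val s)) = Phi (val s).
    apply/ffunP => i; rewrite sum_ffunE ffunE (bigD1 i)//= ffunE eqxx.
    by rewrite big1 ?addr0// => j /negPf ji; rewrite ffunE eq_sym ji.
  apply: uQ; exists 1, (val s); rewrite scale1r mul1r; split=> //.
  by case: s => A /= /set_mem[g _ <-]; exact: hS.
by apply: me; rewrite linear_sum big1// => i _; rewrite (fP i).2.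
Qed.

End tests.

(** * Ergodic nets *)

Lemma tails_filter (I : Type) (le : I -> I -> Prop) :
  directed_set le -> Filter (tails le).
Proof.
move=> [[i0] refl trans dir]; split; first by exists i0.
  move=> P Q [i iP] [j jQ]; have [l [il jl]] := dir i j; exists l => n ln.
  by split; [apply: iP; exact: trans ln|apply: jQ; exact: trans ln].
by move=> P Q PQ [i iP]; exists i => j ij; apply: PQ; exact: iP.
Qed.

Section nets.
Context (R : realType) (k : scalar_kind) (X : normedModType (scalars R k)).
Context (G : semitopSemigroupType) (S : bounded_representation X G).
Local Notation K := (scalars R k).
Local Notation TS := (rep_semigroup S).

(** The net is indexed by the pairs (s, e) of a finite list of tests and a
    tolerance, ordered by inclusion of s and by decreasing e; the operator at
    (s, e) passes all the tests in s up to e. *)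
Lemma vanishing_net (J : choiceType) (D : J -> bop X -> X)
    (m : {scalar bcfun K TS}) :
  is_mean m -> (forall j, annihilated m (D j)) ->
  exists (I : Type) (le : I -> I -> Prop) (A : I -> bop X),
    [/\ directed_set le, forall i, convex_hull (range S) (A i) &
        forall j, D j (A i) @[i --> tails le] --> (0 : X)].
Proof.
move=> mm Dm; pose I := (seq J * {posnum R})%type.
pose le (i i' : I) := {subset i.1 <= i'.1} /\ i'.2%:num <= i.2%:num.
have /choice[A AP] (i : I) : exists A, convex_hull (range S) A /\
    forall j, j \in i.1 -> to_real `|D j A| < i.2%:num.
  case: i => s e; have [|//|A hA As] :=
    @tests_small_on_convex_hull R k X G S (seq_sub s) (D \o val) m e%:num mm.
    by move=> j; exact: Dm.
  by exists A; split=> // j js; exact: (As (SeqSub js)).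
have dir : directed_set le.
  split.
  - exact: (inhabits ([::], 1%:pos)).
  - by move=> i; split.
  - by move=> i j l [ij ji] [jl lj]; split=> [x /ij /jl//|]; exact: le_trans ji.
  - move=> [s e] [s' e']; exists (s ++ s', Order.min e e'); split; split=> //=.
    + by move=> j; rewrite mem_cat => ->.
    + by rewrite num_min ge_min lexx.
    + by move=> j; rewrite mem_cat orbC => ->.
    + by rewrite num_min ge_min lexx orbT.
exists I, le, A; split=> // [i|j]; first exact: (AP i).1.
have FF := tails_filter dir; apply/cvgr0Pnorm_lt => e e0.
have re0 : 0 < to_real e by rewrite -(of_real_lt k) rmorph0 to_realK// ltW.
exists ([:: j], PosNum re0) => i [ji ie].
rewrite -[e]to_realK ?ltW// -[`|_|]to_realK// of_real_lt.
apply: lt_le_trans ie; apply: (AP i).2; apply: ji; exact: mem_head.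
Qed.

End nets.

Theorem corollary1p5 (R : realType) (k : scalar_kind)
    (X : completeNormedModType (scalars R k)) (G : semitopSemigroupType)
    (S : bounded_representation X G) :
  (amenable (scalars R k) (rep_semigroup S) ->
     exists (I : Type) (le : I -> I -> Prop) (A : I -> bop X),
       strong_ergodic_net S le A) /\
  (right_amenable (scalars R k) (rep_semigroup S) ->
     exists (I : Type) (le : I -> I -> Prop) (A : I -> bop X),
       strong_right_ergodic_net S le A).
Proof.
split=> [[m [mm [rm lm]]]|[m [mm rm]]].
  pose D (j : X * G + X * G) (A : bop X) : X :=
    match j with
    | inl (x, g) => A x - A (S g x)
    | inr (x, g) => A x - S g (A x)
    end.
  have [|I [le [A [dir hA DA]]]] := vanishing_net (D := D) mm.
    move=> [[x g]|[x g]]; first exact: right_test_annihilated.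
    exact: left_test_annihilated.
  exists I, le, A; split; split=> // [i|x g].
  - by apply: subset_closure; exact: hA.
  - exact: (DA (inl (x, g))).
  - by apply: subset_closure; exact: hA.
  - exact: (DA (inr (x, g))).
pose D (j : X * G) (A : bop X) : X := A j.1 - A (S j.2 j.1).
have [|I [le [A [dir hA DA]]]] := vanishing_net (D := D) mm.
  by move=> [x g]; exact: right_test_annihilated.
exists I, le, A; split=> // [i|x g]; first by apply: subset_closure; exact: hA.
exact: (DA (x, g)).
Qed.
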